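(* (i) For any prime number $s$ and any positive integers $q\le p$ with $s^p-1\ge 2$, there exists a $\mathrm{GSOA}(s^p,\,s^p-1,\,s^q,\,t)$ attaining the lower bounds $G^{\rm LB}$ and $\Phi_{\rm SD}^{\rm LB}$, with $t=2$ if $s=2$ and $t=1$ if $s>2$. (ii) For any odd prime $s$ and any positive integer $p$ with $(s^p-1)/2\ge 2$, there exists a $\mathrm{GSOA}\bigl(s^p,\,(s^p-1)/2,\,s^p,\,t\bigr)$ attaining the lower bounds $G^{\rm LB}$ and $\Phi_{\rm SD}^{\rm LB}$, with $t=2$ if $s=3$ and $t=1$ if $s>3$.
   Context: Notation: for a positive integer $r$, $\mathbb{Z}_r=\{0,1,\ldots,r-1\}$. An $(n,m,s^h)$ design is an $n\times m$ matrix $D=(x_{ik})$ with entries in $\mathbb{Z}_{s^h}$ (rows may repeat). Orthogonal arrays. An $\mathrm{OA}(n,g,s_1\times\cdots\times s_g,t)$ is an $n\times g$ matrix whose $j$th column takes values in $\mathbb{Z}_{s_j}$ and such that in any $t$-column subarray all possible level combinations appear equally often. GSOA. A general strong orthogonal array $\mathrm{GSOA}(n,m,s^h,t)$ is an $(n,m,s^h)$ design such that any subarray of $g$ columns ($1\le g\le t$) can be collapsed into an $\mathrm{OA}(n,g,s^{u_1}\times\cdots\times s^{u_g},g)$ for any positive integers $u_1,\ldots,u_g$ with $u_1+\cdots+u_g=t$ and $u_i\le h$; here the collapsing map from $s^h$ levels to $s^u$ levels is $x\mapsto\lfloor x/s^{h-u}\rfloor$. A design is U-type if each of its columns contains every level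 equally often; the bounds below concern U-type designs. Weights and distances for designs with $s^h$ levels. Let $\omega:\{0,\ldots,h\}\to[0,\infty)$ be a (given) weight function with $\omega(i)>0$ for at least one $i$. Put $z_{ik}=(2x_{ik}+1)/(2s^h)\in[0,1)$, $\delta_i(x,y)=1$ if $\lfloor s^ix\rfloor=\lfloor s^iy\rfloor$ and $0$ otherwise, and $$d_{ab}=\sum_{k=1}^m\sum_{i=0}^h\frac{\omega(i)}{s^i}\{1-\delta_i(z_{ak},z_{bk})\},\qquad G_D=\sum_{a=1}^n\sum_{b=1}^n d_{ab}^2 .$$ Criterion. For $u\in\{0,\ldots,h\}$, $x\in[0,1)$ let $R_u(x)=[\lfloor s^ux\rfloor/s^u,\lfloor s^ux\rfloor/s^u+1/s^u)$. For $n$ points $P$ (with multiplicity) in $[0,1)^2$, $$\mathrm{SD}^2(P)=\sum_{u_1,u_2=0}^{h}\omega(u_1)\omega(u_2)\int_{[0,1)^2}\left|s^{-u_1-u_2}-\frac{|P\cap(R_{u_1}(x_1)\times R_{u_2}(x_2))|}{n}\right|^2dx_1dx_2,$$ and for $m\ge2$, $\Phi_{\rm SD}(D)=\frac{2}{m(m-1)}\sum_{1\le k<l\le m}\mathrm{SD}^2(P_{kl})$ with $P_{kl}=\{(z_{ik},z_{il})\}_{i=1}^n$. Lower bounds. With $A_0=\sum_{i=0}^h\omega(i)s^{-i}$, $A_1=\sum_{i=0}^h\omega(i)s^{-2i}$, $B=\sum_{i=0}^h\omega(i)^2s^{-3i}$, $C=\sum_{0\le i<j\le h}\omega(i)\omega(j)s^{-i-2j}$,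 put $$G^{\rm LB}=\frac{n^3m^2}{n-1}(A_0-A_1)^2,$$ $$\Phi_{\rm SD}^{\rm LB}=\frac{m}{(n-1)(m-1)}A_0^2-\frac{2m}{(n-1)(m-1)}A_0A_1+\frac{n+m-1}{(n-1)(m-1)}A_1^2-\frac{1}{m-1}B-\frac{2}{m-1}C .$$ A design $D$ ''attains the lower bounds'' if it is U-type, $G_D=G^{\rm LB}$ and $\Phi_{\rm SD}(D)=\Phi_{\rm SD}^{\rm LB}$. In (i) these are taken with $n=s^p$, $m=s^p-1$, $h=q$; in (ii) with $n=s^p$, $m=(s^p-1)/2$, $h=p$. *)

(* Defs.v *)
From HB Require Import structures.
From mathcomp Require Import all_boot all_order all_algebra.
From mathcomp Require Import all_classical all_reals all_analysis.

Set Implicit Arguments.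
Unset Strict Implicit.
Unset Printing Implicit Defensive.
Import Order.TTheory GRing.Theory Num.Theory.
Import numFieldNormedType.Exports.
Local Open Scope ring_scope.

Definition design (n m s h : nat) := 'M['I_(s ^ h)%N]_(n, m).

(* Level combinations on the set of columns [J] are represented by functions
   on all columns, of which only the values on [J] matter. *)
Definition is_OA (n g : nat) (A : 'M[nat]_(n, g)) (lev : 'I_g -> nat)
    (t : nat) : Prop :=
  (forall i j, (A i j < lev j)%N) /\
  (forall J : {set 'I_g}, #|J| = t ->
    forall v w : 'I_g -> nat,
      (forall j, j \in J -> (v j < lev j)%N) ->
      (forall j, j \in J -> (w j < lev j)%N) ->
      #|[pred i : 'I_n | [forall j in J, A i j == v j]]| =
      #|[pred i : 'I_n | [forall j in J, A i j == w j]]|).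

Definition collapse (s h u x : nat) : nat := (x %/ s ^ (h - u))%N.

(* The subarray is given by the injective family [c] of its column indices. *)
Definition is_GSOA (n m s h : nat) (D : design n m s h) (t : nat) : Prop :=
  forall g : nat, (1 <= g <= t)%N ->
  forall c : 'I_g -> 'I_m, injective c ->
  forall u : 'I_g -> nat,
    (forall j, (0 < u j <= h)%N) -> (\sum_(j < g) u j)%N = t ->
    is_OA (\matrix_(i < n, j < g) collapse s h (u j) (D i (c j)))
          (fun j => (s ^ u j)%N) g.

Definition is_Utype (n m s h : nat) (D : design n m s h) : Prop :=
  forall (k : 'I_m) (x y : 'I_(s ^ h)%N),
    #|[pred i : 'I_n | D i k == x]| = #|[pred i : 'I_n | D i k == y]|.

Definition is_weight (R : realType) (h : nat) (w : 'I_h.+1 -> R) : Prop :=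
  (forall i, 0 <= w i) /\ (exists i, 0 < w i).

Definition zpt (R : realType) (n m s h : nat) (D : design n m s h)
    (i : 'I_n) (k : 'I_m) : R :=
  (2 * D i k + 1)%N%:R / (2 * s ^ h)%N%:R.

Definition delta (R : realType) (s i : nat) (x y : R) : R :=
  (Num.floor (s%:R ^+ i * x) == Num.floor (s%:R ^+ i * y))%:R.

Definition dist (R : realType) (n m s h : nat) (w : 'I_h.+1 -> R)
    (D : design n m s h) (a b : 'I_n) : R :=
  \sum_(k < m) \sum_(i < h.+1)
    w i / s%:R ^+ i * (1 - delta s i (zpt R D a k) (zpt R D b k)).

Definition G_crit (R : realType) (n m s h : nat) (w : 'I_h.+1 -> R)
    (D : design n m s h) : R :=
  \sum_(a < n) \sum_(b < n) dist w D a b ^+ 2.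

Definition cell (R : realType) (s u : nat) (x : R) : interval R :=
  let a := (Num.floor (s%:R ^+ u * x))%:~R / s%:R ^+ u in
  `[a, a + 1 / s%:R ^+ u[.

(* The [n] points, counted with multiplicity, are a family indexed by ['I_n]. *)
Definition SD2 (R : realType) (s h n : nat) (w : 'I_h.+1 -> R)
    (P : 'I_n -> R * R) : R :=
  \sum_(u1 < h.+1) \sum_(u2 < h.+1) w u1 * w u2 *
    Rintegral (lebesgue_measure \x lebesgue_measure)%E
      (`[0, 1[%classic `*` `[0, 1[%classic)%classic
      (fun x : R * R =>
        `| (s%:R ^+ (u1 + u2))^-1
           - #|[pred i | ((P i).1 \in cell s u1 x.1)
                         && ((P i).2 \in cell s u2 x.2)]|%:R / n%:R | ^+ 2).

Definition Phi_SD (R : realType) (n m s h : nat) (w : 'I_h.+1 -> R)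
    (D : design n m s h) : R :=
  2 / (m%:R * (m%:R - 1)) *
  \sum_(k < m) \sum_(l < m | (k < l)%N)
    SD2 s w (fun i : 'I_n => (zpt R D i k, zpt R D i l)).

Section LowerBounds.
Variables (R : realType) (n m s h : nat) (w : 'I_h.+1 -> R).

Definition A0 : R := \sum_(i < h.+1) w i / s%:R ^+ i.
Definition A1 : R := \sum_(i < h.+1) w i / s%:R ^+ (2 * i).
Definition Bsum : R := \sum_(i < h.+1) w i ^+ 2 / s%:R ^+ (3 * i).
Definition Csum : R :=
  \sum_(i < h.+1) \sum_(j < h.+1 | (i < j)%N)
    w i * w j / s%:R ^+ (i + 2 * j).

Definition G_LB : R :=
  n%:R ^+ 3 * m%:R ^+ 2 / (n%:R - 1) * (A0 - A1) ^+ 2.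

Definition Phi_SD_LB : R :=
  m%:R / ((n%:R - 1) * (m%:R - 1)) * A0 ^+ 2
  - 2 * m%:R / ((n%:R - 1) * (m%:R - 1)) * A0 * A1
  + (n%:R + m%:R - 1) / ((n%:R - 1) * (m%:R - 1)) * A1 ^+ 2
  - 1 / (m%:R - 1) * Bsum
  - 2 / (m%:R - 1) * Csum.

End LowerBounds.

Definition attains_LB (R : realType) (n m s h : nat) (w : 'I_h.+1 -> R)
    (D : design n m s h) : Prop :=
  [/\ is_Utype D, G_crit w D = G_LB n m s w
    & Phi_SD w D = Phi_SD_LB n m s w].

(* Main.v *)
Require Import Defs.
From mathcomp Require Import all_boot all_order all_algebra all_field.
From mathcomp Require Import all_classical all_reals all_analysis.
From mathcomp Require Import measurable_realfun.
From mathcomp Require Import zify ring.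

(** Let F be the field with s^p elements and l_0, ..., l_(p-1) its coordinates
    over F_s. Index rows by the elements a of F, columns by the elements c of a
    set A of nonzero elements, and let the entry at (a, c) be the number whose
    base-s digits are l_0(ca), ..., l_(q-1)(ca). Collapsing keeps the leading
    digits, so two rows a, b agree in column c after collapsing iff the leading
    coordinates of c(a - b) vanish. Hence d_ab is a sum over c in A of an even
    function of c(a - b). When A consists of all nonzero elements, or of one
    element from each pair {x, -x}, this sum does not depend on a - b <> 0: the
    design is equidistant. For a U-type design, the discrepancy is an affine
    function of G_D, and equidistance gives the equality case in both bounds.
    Strength 2 amounts to no two columns being proportional over F_s, which
    holds for s = 2 (all nonzero elements) and s = 3 (half of them). *)

Set Implicit Arguments.
Unset Strict Implicit.
Unset Printing Implicit Defensive.
Import Order.TTheory GRing.Theory Num.Theory.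
Import numFieldNormedType.Exports.
Local Open Scope ring_scope.

(** * Integrals of step functions *)

Lemma Rintegral_sum_indic d (T : measurableType d) (R : realType)
    (mu : {measure set T -> \bar R}) (A : set T) (I : finType)
    (r : R) (a : I -> R) (E : I -> set T) :
  measurable A -> (mu A < +oo)%E -> (forall i, measurable (E i)) ->
  Rintegral mu A (fun x => r + \sum_i a i * \1_(E i) x) =
  r * fine (mu A) + \sum_i a i * fine (mu (E i `&` A)%classic).
Proof.
move=> mA muA mE.
have indic_int (c : R) B : measurable B ->
    mu.-integrable A (fun x => (c * \1_B x)%:E).
  move=> mB; under eq_fun do rewrite EFinM; apply: integrableZl => //.
  apply/integrableP; split; first exact/measurable_EFinP.
  rewrite (eq_integral (fun x => (\1_B x)%:E)); last first.
    by move=> t _; rewrite gee0_abs// lee_fin.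
  rewrite integral_indic//; apply: le_lt_trans muA.
  by apply: le_measure; rewrite ?inE//; exact: measurableI.
have sum_int : mu.-integrable A (EFin \o (fun x => \sum_i a i * \1_(E i) x)).
  rewrite [X in integrable _ _ X](_ : _ =
      fun x => (\sum_i (a i * \1_(E i) x)%:E)%E).
    by apply: integrable_sum => // i _; exact: indic_int.
  by apply/funext => x /=; rewrite sumEFin.
rewrite RintegralD // ?Rintegral_cst //; last first.
  have := indic_int r setT measurableT.
  by under eq_fun do rewrite indicT mulr1.
congr (_ + _); rewrite /Rintegral.
under eq_integral do rewrite -sumEFin.
rewrite integral_sum //; last by move=> i; exact: indic_int.
have term_int i : (\int[mu]_(x in A) (a i * \1_(E i) x)%:E =
    (a i * fine (mu (E i `&` A)%classic))%:E)%E.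
  under eq_integral do rewrite EFinM.
  rewrite integralZl //; last first.
    have := indic_int 1 (E i) (mE i).
    by under eq_fun do rewrite mul1r.
  rewrite integral_indic // EFinM fineK // ge0_fin_numE //.
  apply: le_lt_trans muA.
  by apply: le_measure; rewrite ?inE//; exact: measurableI.
by under eq_bigr do rewrite term_int; rewrite sumEFin.
Qed.

(** * Cells of the unit interval and the discrepancy integral *)

(** The point is the midpoint of its finest cell: scaling by [s ^ u] gives [(2x+1)/(2 s^(h-u))],
    whose integer part is the quotient of [x] by [s ^ (h - u)]. *)
Lemma floor_zpt (R : realType) (n m s h : nat) (D : design n m s h)
    (i : 'I_n) (k : 'I_m) (u : nat) : (0 < s)%N -> (u <= h)%N ->
  Num.floor (s%:R ^+ u * zpt R D i k) = collapse s h u (D i k).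
Proof.
move=> s0 uh; rewrite /zpt /collapse; set x := nat_of_ord _.
have M0 : (0 < s ^ (h - u))%N by rewrite expn_gt0 s0.
have -> : s%:R ^+ u * ((2 * x + 1)%N%:R / (2 * s ^ h)%N%:R) =
          (2 * x + 1)%N%:R / (2 * s ^ (h - u))%N%:R :> R.
  rewrite -{1}(subnKC uh) expnD !natrM !natrX; field.
  by rewrite !expf_neq0 // pnatr_eq0 -lt0n.
apply: floor_def; set y := _ / _.
rewrite [_ + 1]addrC -intS -!pmulrn /y.
rewrite ler_pdivlMr ?ltr0n ?muln_gt0 // ltr_pdivrMr ?ltr0n ?muln_gt0 //.
rewrite -!natrM ler_nat ltr_nat.
have := divn_eq x (s ^ (h - u)); have := ltn_pmod x M0.
move: (s ^ _)%N M0 (x %% _)%N (x %/ _)%N => M M0 r q rM ->.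
by apply/andP; split; nia.
Qed.

Lemma deltaE (R : realType) (n m s h : nat) (D : design n m s h)
    (a b : 'I_n) (k : 'I_m) (u : nat) : (0 < s)%N -> (u <= h)%N ->
  delta s u (zpt R D a k) (zpt R D b k) =
  (collapse s h u (D a k) == collapse s h u (D b k))%:R :> R.
Proof. by move=> s0 uh; rewrite /delta !floor_zpt. Qed.

(** This form is symmetric in [x] and [y], so the roles of point and cell centre can be
    exchanged. *)
Lemma mem_cell (R : realType) (s u : nat) (x y : R) : (0 < s)%N ->
  (x \in cell s u y) = (Num.floor (s%:R ^+ u * x) == Num.floor (s%:R ^+ u * y)).
Proof.
move=> s0; rewrite /cell in_itv /=; set f := Num.floor (_ * y).
have S0 : 0 < s%:R ^+ u :> R by rewrite exprn_gt0 // ltr0n.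
rewrite -mulrDl ler_pdivrMr // ltr_pdivlMr // [x * _]mulrC.
rewrite eq_sym -[1]/(1%:~R) -intrD.
by apply/idP/eqP => [/floor_def //|->]; rewrite floor_le floorD1_gt.
Qed.

Lemma zpt_itv (R : realType) (n m s h : nat) (D : design n m s h)
    (i : 'I_n) (k : 'I_m) : zpt R D i k \in `[0, 1[.
Proof.
have := ltn_ord (D i k); rewrite in_itv /= /zpt; move: (nat_of_ord _) => x xs.
rewrite divr_ge0 //= ltr_pdivrMr ?mul1r ?ltr_nat ?ltr0n; nia.
Qed.

Lemma cell_sub01 (R : realType) (s u : nat) (y : R) : (0 < s)%N ->
  y \in `[0, 1[ -> ([set` cell s u y] `<=` `[0%R, 1%R[)%classic.
Proof.
move=> s0; rewrite in_itv /= => /andP[y0 y1] x /=; rewrite /cell !in_itv /=.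
set S := s%:R ^+ u; have S0 : 0 < S by rewrite exprn_gt0 // ltr0n.
have f0 : 0 <= Num.floor (S * y) by rewrite floor_ge0 mulr_ge0 // ltW.
have f1 : Num.floor (S * y) + 1 <= (s ^ u)%N%:Z.
  rewrite lezD1 -(@ltr_int R) -pmulrn natrX -/S.
  apply: (le_lt_trans (floor_le _)).
  by rewrite -[ltRHS]mulr1 ltr_pM2l.
move=> /andP[le_x lt_x]; apply/andP; split.
  by apply: le_trans le_x; rewrite divr_ge0 ?ler0z // ltW.
apply: lt_le_trans lt_x _; rewrite -mulrDl ler_pdivrMr // mul1r.
by move: f1; rewrite -(@ler_int R) intrD -pmulrn natrX.
Qed.

Lemma lebesgue_cell (R : realType) (s u : nat) (y : R) : (0 < s)%N ->
  lebesgue_measure [set` cell s u y] = ((s%:R ^+ u)^-1)%:E.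
Proof.
move=> s0; have S0 : 0 < s%:R ^+ u :> R by rewrite exprn_gt0 // ltr0n.
rewrite lebesgue_measure_itv /= lte_fin ltrDl divr_gt0 // -EFinB.
by rewrite addrAC subrr add0r div1r.
Qed.

(** A point lies in the cell of [x] iff [x] lies in the rectangle [Q i] around that point, so the
    count is a sum of indicators. Rectangles of one scale are equal or disjoint; products of two
    indicators are therefore multiples of one, and the squared integrand is linear in indicators. *)
Lemma Rintegral_cells (R : realType) (n s u1 u2 : nat) (P : 'I_n -> R * R) :
  (0 < n)%N -> (0 < s)%N ->
  (forall i, ((P i).1 \in `[0, 1[) /\ ((P i).2 \in `[0, 1[)) ->
  Rintegral (lebesgue_measure \x lebesgue_measure)%E
    (`[0, 1[%classic `*` `[0, 1[%classic)%classic
    (fun x : R * R =>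
      `| (s%:R ^+ (u1 + u2))^-1
         - #|[pred i | ((P i).1 \in cell s u1 x.1)
                       && ((P i).2 \in cell s u2 x.2)]|%:R / n%:R | ^+ 2) =
  n%:R ^- 2 * (\sum_(i < n) \sum_(j < n)
     (delta s u1 (P i).1 (P j).1 / s%:R ^+ u1) *
     (delta s u2 (P i).2 (P j).2 / s%:R ^+ u2))
  - (s%:R ^+ (2 * u1))^-1 * (s%:R ^+ (2 * u2))^-1.
Proof.
move=> n0 s0 P01.
have nR0 : n%:R != 0 :> R by rewrite pnatr_eq0 -lt0n.
have S0 u : s%:R ^+ u != 0 :> R by rewrite expf_neq0 // pnatr_eq0 -lt0n.
pose Q i := ([set` cell s u1 (P i).1] `*` [set` cell s u2 (P i).2])%classic.
pose dd i j := delta s u1 (P i).1 (P j).1 * delta s u2 (P i).2 (P j).2.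
pose c : R := (s%:R ^+ (u1 + u2))^-1.
have measQ i : measurable (Q i).
  by apply: measurableX; exact: measurable_itv.
have unit_sq : (lebesgue_measure \x lebesgue_measure)%E
    (`[0%R, 1%R[%classic `*` `[0%R, 1%R[%classic)%classic = 1%:E :> \bar R.
  rewrite product_measure1E //; try exact: measurable_itv.
  by rewrite /= lebesgue_measure_itv /= lte_fin ltr01 oppr0 adde0 mule1.
have muQ i : (lebesgue_measure \x lebesgue_measure)%E
    (Q i `&` (`[0%R, 1%R[%classic `*` `[0%R, 1%R[%classic))%classic = c%:E.
  have [P1 P2] := P01 i.
  rewrite setIidl; last first.
    by move=> x [/= x1 x2]; split; [exact: cell_sub01 x1 | exact: cell_sub01 x2].
  rewrite product_measure1E //; try exact: measurable_itv.
  by rewrite /= !lebesgue_cell // -EFinM -invfM -exprD.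
have QE i x : \1_(Q i) x =
    (((P i).1 \in cell s u1 x.1) && ((P i).2 \in cell s u2 x.2))%:R :> R.
  rewrite indicE; congr (nat_of_bool _)%:R.
  rewrite !mem_cell // [X in X && _]eq_sym [X in _ && X]eq_sym -!mem_cell //.
  by rewrite /Q in_setX !mem_setE.
have QM i j x : \1_(Q i) x * \1_(Q j) x = dd i j * \1_(Q i) x :> R.
  rewrite !QE /dd /delta !mem_cell //.
  by do 2!case: eqP => [->|_]; rewrite ?mulr0 ?mul0r ?mulr1 ?mul1r ?andbF //=;
    rewrite 1?mulrC // -natrM mulnb eq_sym // [X in _ && X]eq_sym.
(* With [X] the count, [(c - X/n)^2] is expanded and [X^2] replaced by its linear form. *)
transitivity (Rintegral (lebesgue_measure \x lebesgue_measure)%E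
    (`[0, 1[%classic `*` `[0, 1[%classic)%classic
    (fun x => c ^+ 2 + \sum_i
      (n%:R ^- 2 * (\sum_j dd i j) - 2 * c / n%:R) * \1_(Q i) x)).
  apply: eq_Rintegral => x _.
  rewrite real_normK ?num_real // -/c.
  have -> : #|[pred i | ((P i).1 \in cell s u1 x.1)
                       && ((P i).2 \in cell s u2 x.2)]|%:R =
            \sum_i \1_(Q i) x :> R.
    rewrite -sum1_card natr_sum big_mkcond /=.
    by apply: eq_bigr => i _; rewrite QE inE; case: ifP.
  have sqE : (\sum_i \1_(Q i) x) ^+ 2 =
      \sum_i (\sum_j dd i j) * \1_(Q i) x :> R.
    rewrite expr2 mulr_suml; apply: eq_bigr => i _.
    by rewrite mulr_sumr mulr_suml; apply: eq_bigr => j _; rewrite QM.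
  under [in RHS]eq_bigr do rewrite mulrBl -[_ * _ * _ in X in X - _]mulrA.
  rewrite sumrB -!mulr_sumr -sqE; set X := \sum_i _.
  by field.
rewrite Rintegral_sum_indic //; last 2 first.
- by apply: measurableX; exact: measurable_itv.
- by rewrite [X in (X < _)%E]unit_sq ltry.
rewrite [X in _ * fine X]unit_sq /=.
under eq_bigr => i _.
  rewrite [X in _ * fine X]muQ /= mulrBl -[_ * _ * _ in X in X - _]mulrA mulr_suml.
  over.
rewrite sumrB -mulr_sumr sumr_const card_ord.
have -> : \sum_i \sum_j dd i j * c = \sum_(i < n) \sum_(j < n)
     (delta s u1 (P i).1 (P j).1 / s%:R ^+ u1) *
     (delta s u2 (P i).2 (P j).2 / s%:R ^+ u2).
  apply: eq_bigr => i _; apply: eq_bigr => j _.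
  by rewrite /dd /c exprD invfM mulrACA.
rewrite /c mulnC [(2 * u2)%N]mulnC !exprM exprD -[_ *+ n]mulr_natr.
set X := \sum_(_ < _) _.
by field; rewrite nR0 !S0.
Qed.

(** * Double sums and level counts in U-type designs *)

Lemma sum_offdiag_sym (R : comNzRingType) (n : nat) (F : 'I_n -> 'I_n -> R) :
  (forall i j, F i j = F j i) ->
  2 * \sum_(i < n) \sum_(j < n | (i < j)%N) F i j =
  \sum_i \sum_j F i j - \sum_i F i i.
Proof.
move=> Fsym.
have -> : \sum_i \sum_j F i j = \sum_(i < n) F i i +
    (\sum_(i < n) \sum_(j < n | (i < j)%N) F i j +
     \sum_(i < n) \sum_(j < n | (j < i)%N) F i j).
  rewrite -!big_split /=; apply: eq_bigr => i _.
  rewrite (bigD1 i) //=; congr (_ + _).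
  rewrite (bigID (fun j : 'I_n => (i < j)%N)) /=.
  by congr (_ + _); apply: eq_bigl => j;
    rewrite -(inj_eq val_inj) /=; case: ltngtP.
rewrite [X in _ + (_ + X)](exchange_big_dep xpredT) //=.
under [X in _ + (_ + X)]eq_bigr do under eq_bigr do rewrite Fsym.
by ring.
Qed.

Lemma card_divn_eq (M K v : nat) : (0 < M)%N -> (v < K)%N ->
  #|[pred x : 'I_(M * K) | x %/ M == v]%N| = M.
Proof.
move=> M0 vK.
have bnd (r : 'I_M) : (v * M + r < M * K)%N by have := ltn_ord r; nia.
pose f r := Ordinal (bnd r).
have f_inj : injective f.
  by move=> r r' /(congr1 val) /= /addnI /val_inj.
rewrite -[RHS]card_ord -(card_codom f_inj); apply: eq_card => x.
rewrite inE; apply/eqP/codomP => [E|[r ->]] /=.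
  have rM := ltn_pmod x M0; exists (Ordinal rM).
  by apply: val_inj; rewrite /= -E -divn_eq.
by rewrite divnMDl // divn_small ?addn0.
Qed.

(** All [s ^ h] levels share one frequency [lam], so [lam * s ^ h = n], and exactly [s ^ (h - u)]
    levels collapse to [v]. *)
Lemma card_collapse (n m s h : nat) (D : design n m s h) (k : 'I_m)
    (u v : nat) : (0 < s)%N -> is_Utype D -> (u <= h)%N -> (v < s ^ u)%N ->
  (#|[pred i | collapse s h u (D i k) == v]| * s ^ u = n)%N.
Proof.
move=> s0 UD uh vu; have sh0 : (0 < s ^ h)%N by rewrite expn_gt0 s0.
pose lam := #|[pred i : 'I_n | D i k == Ordinal sh0]|.
have lamE x : #|[pred i : 'I_n | D i k == x]| = lam by exact: UD.
have fib (A : pred 'I_(s ^ h)) : #|[pred i : 'I_n | A (D i k)]| = (lam * #|A|)%N.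
  rewrite -sum1_card (partition_big (fun i => D i k) A) //=.
  rewrite mulnC -sum_nat_const; apply: eq_bigr => x Ax.
  rewrite -(lamE x) -sum1_card; apply: eq_bigl => i; rewrite !inE.
  by case: eqP => [->|]; rewrite ?andbF ?andbT.
have n_eq : (lam * s ^ h = n)%N.
  by rewrite -[RHS]card_ord -[X in (_ * X)%N]card_ord -(fib predT).
rewrite (fib [pred x : 'I_(s ^ h) | collapse s h u x == v]).
have -> : #|[pred x : 'I_(s ^ h) | collapse s h u x == v]| = (s ^ (h - u))%N.
  have M0 : (0 < s ^ (h - u))%N by rewrite expn_gt0 s0.
  have := card_divn_eq M0 vu; rewrite -expnD subnK //.
by rewrite -mulnA -expnD subnK.
Qed.

Lemma collapse_collapse (s h u v x : nat) : (u <= v)%N -> (v <= h)%N ->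
  collapse s h u x = (collapse s h v x %/ s ^ (v - u))%N.
Proof.
move=> uv vh; rewrite /collapse -divnMA -expnD; congr (_ %/ _ ^ _)%N; lia.
Qed.

Lemma collapse_lt (s h u x : nat) : (0 < s)%N -> (u <= h)%N ->
  (x < s ^ h)%N -> (collapse s h u x < s ^ u)%N.
Proof.
by move=> s0 uh; rewrite ltn_divLR ?expn_gt0 ?s0 // -expnD subnKC.
Qed.

Lemma sum_delta (R : realType) (n m s h : nat) (D : design n m s h) (k : 'I_m)
    (u : nat) : (0 < s)%N -> is_Utype D -> (u <= h)%N ->
  \sum_(a < n) \sum_(b < n) delta s u (zpt R D a k) (zpt R D b k) =
  n%:R ^+ 2 / s%:R ^+ u.
Proof.
move=> s0 UD uh; have S0 : s%:R ^+ u != 0 :> R.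
  by rewrite expf_neq0 // pnatr_eq0 -lt0n.
have sumb a : \sum_(b < n) delta s u (zpt R D a k) (zpt R D b k) =
    n%:R / s%:R ^+ u.
  under eq_bigr do rewrite deltaE // eq_sym.
  have /(congr1 (fun x => x%:R : R)) := card_collapse k s0 UD uh
    (collapse_lt s0 uh (ltn_ord (D a k))).
  rewrite natrM natrX => <-; rewrite mulfK // -natr_sum -sum1_card.
  by rewrite [in RHS]big_mkcond; congr _%:R; apply: eq_bigr => i _;
    rewrite inE; case: eqP.
by under eq_bigr do rewrite sumb; rewrite sumr_const card_ord -mulr_natl; ring.
Qed.

(** Cells are nested: agreement at the finer scale [v] forces agreement at the coarser scale [u]. *)
Lemma deltaM (R : realType) (n m s h : nat) (D : design n m s h) (k : 'I_m)
    (a b : 'I_n) (u v : nat) : (0 < s)%N -> (u <= v)%N -> (v <= h)%N ->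
  delta s u (zpt R D a k) (zpt R D b k) *
  delta s v (zpt R D a k) (zpt R D b k) =
  delta s v (zpt R D a k) (zpt R D b k).
Proof.
move=> s0 uv vh; rewrite !deltaE //; last exact: leq_trans uv vh.
rewrite !(collapse_collapse _ _ uv vh).
by case: (collapse s h v _ =P collapse s h v _) => [->|_]; rewrite ?eqxx ?mulr1 ?mulr0.
Qed.

(** * Coincidences of rows and the two criteria *)

(** This is [A0] minus the contribution of column [k] to [dist]. Both criteria are quadratic in it:
    [dist] involves its sum over columns, [SD2] its products over two columns. *)
Definition coincidence (R : realType) (n m s h : nat) (w : 'I_h.+1 -> R)
    (D : design n m s h) (k : 'I_m) (a b : 'I_n) : R :=
  \sum_(u < h.+1) w u * (delta s u (zpt R D a k) (zpt R D b k) / s%:R ^+ u).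

Lemma dist_coincidence (R : realType) (n m s h : nat) (w : 'I_h.+1 -> R)
    (D : design n m s h) (a b : 'I_n) :
  dist w D a b = m%:R * A0 s w - \sum_k coincidence w D k a b.
Proof.
rewrite mulr_natl -[X in _ *+ X](card_ord m) -sumr_const -sumrB /dist.
apply: eq_bigr => k _; rewrite /A0 /coincidence -sumrB.
by apply: eq_bigr => u _; rewrite mulrBr mulr1 -mulrA [_^-1 * _]mulrC.
Qed.

Lemma sum_coincidence (R : realType) (n m s h : nat) (w : 'I_h.+1 -> R)
    (D : design n m s h) (k : 'I_m) : (0 < s)%N -> is_Utype D ->
  \sum_a \sum_b coincidence w D k a b = n%:R ^+ 2 * A1 s w.
Proof.
move=> s0 UD; rewrite /coincidence.
under eq_bigr do rewrite exchange_big /=.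
rewrite exchange_big /= /A1 mulr_sumr; apply: eq_bigr => u _.
under eq_bigr do rewrite -mulr_sumr -mulr_suml.
rewrite -mulr_sumr -mulr_suml sum_delta //; last by rewrite -ltnS.
by rewrite mulnC exprM; field; rewrite expf_neq0 // pnatr_eq0 -lt0n.
Qed.

(** Nested cells turn the product of agreements at scales [u] and [v] into agreement at scale
    [maxn u v]. The diagonal [u = v] then yields [Bsum], and the two triangles yield [Csum] each. *)
Lemma sum_coincidence_sqr (R : realType) (n m s h : nat) (w : 'I_h.+1 -> R)
    (D : design n m s h) (k : 'I_m) : (0 < s)%N -> is_Utype D ->
  \sum_a \sum_b coincidence w D k a b ^+ 2 =
  n%:R ^+ 2 * (Bsum s w + 2 * Csum s w).
Proof.
move=> s0 UD.
have S0 u : s%:R ^+ u != 0 :> R by rewrite expf_neq0 // pnatr_eq0 -lt0n.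
pose F (u v : 'I_h.+1) : R := w u * w v * (n%:R ^+ 2 /
  (s%:R ^+ u * s%:R ^+ v * s%:R ^+ (maxn u v))).
have Fsym u v : F u v = F v u.
  by rewrite /F maxnC [w u * _]mulrC [s%:R ^+ u * _]mulrC.
have -> : \sum_a \sum_b coincidence w D k a b ^+ 2 = \sum_u \sum_v F u v.
  have sqE a b : coincidence w D k a b ^+ 2 = \sum_u \sum_v
      w u * w v / (s%:R ^+ u * s%:R ^+ v) *
      delta s (maxn u v) (zpt R D a k) (zpt R D b k).
    rewrite expr2 /coincidence mulr_suml; apply: eq_bigr => u _.
    rewrite mulr_sumr; apply: eq_bigr => v _.
    have -> : delta s (maxn u v) (zpt R D a k) (zpt R D b k) =
        delta s u (zpt R D a k) (zpt R D b k) *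
        delta s v (zpt R D a k) (zpt R D b k).
      have uh : (u <= h)%N by rewrite -ltnS.
      have vh : (v <= h)%N by rewrite -ltnS.
      by case: (leqP u v) => uv; [rewrite deltaM|rewrite mulrC deltaM // ltnW].
    by field; rewrite !S0.
  under eq_bigr do under eq_bigr do rewrite sqE.
  under eq_bigr do rewrite exchange_big /=.
  rewrite exchange_big /=; apply: eq_bigr => u _.
  under eq_bigr do rewrite exchange_big /=.
  rewrite exchange_big /=; apply: eq_bigr => v _.
  under eq_bigr do rewrite -mulr_sumr.
  rewrite -mulr_sumr sum_delta //; last first.
    by rewrite geq_max !leq_ord.
  by rewrite /F; field; rewrite !S0.
have := sum_offdiag_sym Fsym; move/(congr1 (+%R^~ (\sum_i F i i))).
rewrite subrK => <-; rewrite [in RHS]addrC mulrDr; congr (_ + _).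
  rewrite mulrCA; congr (_ * _); rewrite /Csum mulr_sumr.
  apply: eq_bigr => u _; rewrite mulr_sumr; apply: eq_bigr => v uv.
  rewrite /F (maxn_idPr (ltnW uv)) mulnC exprD exprM.
  by field; rewrite !S0.
rewrite /Bsum mulr_sumr; apply: eq_bigr => u _.
by rewrite /F maxnn mulnC exprM; field; rewrite !S0.
Qed.

(** The integral for scales [u1], [u2] is a sum over pairs of rows of a product of one factor per
    coordinate, so the double sum over scales factors into two coincidences. *)
Lemma SD2_coincidence (R : realType) (n m s h : nat) (w : 'I_h.+1 -> R)
    (D : design n m s h) (k l : 'I_m) : (0 < n)%N -> (0 < s)%N ->
  SD2 s w (fun i => (zpt R D i k, zpt R D i l)) =
  n%:R ^- 2 * (\sum_a \sum_b coincidence w D k a b * coincidence w D l a b)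
  - A1 s w ^+ 2.
Proof.
move=> n0 s0; rewrite /SD2.
under eq_bigr do under eq_bigr do
  (rewrite Rintegral_cells //; last (by move=> i; split; exact: zpt_itv)).
have -> : A1 s w ^+ 2 = \sum_(u < h.+1) \sum_(v < h.+1)
    w u * w v * ((s%:R ^+ (2 * u))^-1 * (s%:R ^+ (2 * v))^-1).
  rewrite expr2 /A1 mulr_suml; apply: eq_bigr => u _.
  by rewrite mulr_sumr; apply: eq_bigr => v _; rewrite mulrACA.
under eq_bigr do under eq_bigr do rewrite mulrBr.
under eq_bigr do rewrite sumrB.
rewrite sumrB; congr (_ - _).
under eq_bigr do under eq_bigr do rewrite mulrCA.
under eq_bigr do rewrite -mulr_sumr.
rewrite -mulr_sumr; congr (_ * _).
under eq_bigr do under eq_bigr do rewrite mulr_sumr.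
under eq_bigr do rewrite exchange_big /=.
rewrite exchange_big /=; apply: eq_bigr => a _.
under eq_bigr do under eq_bigr do rewrite mulr_sumr.
under eq_bigr do rewrite exchange_big /=.
rewrite exchange_big /=; apply: eq_bigr => b _.
rewrite /coincidence mulr_suml; apply: eq_bigr => u _.
by rewrite mulr_sumr; apply: eq_bigr => v _; rewrite mulrACA.
Qed.

(* [m * A0 - d_ab] is the total coincidence of rows [a] and [b], so expanding
   its square into pairs of columns relates [G_crit] to [Phi_SD]. *)
Lemma attains_LB_equidistant (R : realType) (n m s h : nat)
    (w : 'I_h.+1 -> R) (D : design n m s h) (K : R) :
  (1 < n)%N -> (1 < m)%N -> (0 < s)%N -> is_Utype D ->
  (forall a b, a != b -> dist w D a b = K) -> attains_LB w D.
Proof.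
move=> n1 m1 s0 UD distK.
have n0 : n%:R != 0 :> R by rewrite pnatr_eq0; lia.
have m0 : m%:R != 0 :> R by rewrite pnatr_eq0; lia.
have n10 : n%:R - 1 != 0 :> R by rewrite subr_eq0 pnatr_eq1; lia.
have m10 : m%:R - 1 != 0 :> R by rewrite subr_eq0 pnatr_eq1; lia.
have distE a b : dist w D a b = (a != b)%:R * K.
  case: eqP => [<-|/eqP /distK ->] /=; last by rewrite mul1r.
  rewrite mul0r /dist big1 // => k _; rewrite big1 // => u _.
  by rewrite /delta eqxx subrr mulr0.
have count_ne : \sum_(a < n) \sum_(b < n) (a != b)%:R = n%:R * (n%:R - 1) :> R.
  have row a : \sum_(b < n) (a != b)%:R = n%:R - 1 :> R.
    transitivity (\sum_(b < n) (1 - (b == a)%:R) : R).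
      by apply: eq_bigr => b _; rewrite eq_sym; case: eqP; rewrite ?subrr ?subr0.
    rewrite sumrB sumr_const card_ord; congr (_ - _).
    by rewrite (bigD1 a) //= eqxx big1 ?addr0 // => b /negbTE ->.
  by under eq_bigr do rewrite row; rewrite sumr_const card_ord mulr_natl.
have sum_dist : \sum_a \sum_b dist w D a b = n%:R * (n%:R - 1) * K.
  under eq_bigr do under eq_bigr do rewrite distE.
  under eq_bigr do rewrite -mulr_suml.
  by rewrite -mulr_suml count_ne.
have sum_dist2 : \sum_a \sum_b dist w D a b ^+ 2 = n%:R * (n%:R - 1) * K ^+ 2.
  have dist2E a b : dist w D a b ^+ 2 = (a != b)%:R * K ^+ 2.
    by rewrite distE exprMn; case: eqP; rewrite ?expr0n ?expr1n.
  under eq_bigr do under eq_bigr do rewrite dist2E.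
  under eq_bigr do rewrite -mulr_suml.
  by rewrite -mulr_suml count_ne.
(* The common distance is forced: the total distance equals [n^2 m (A0 - A1)] by balance of the
   columns. *)
have KE : K = n%:R * m%:R * (A0 s w - A1 s w) / (n%:R - 1).
  suff E : n%:R * (n%:R - 1) * K = n%:R ^+ 2 * m%:R * (A0 s w - A1 s w).
    apply: (@mulfI _ (n%:R * (n%:R - 1))); first by rewrite mulf_neq0.
    by rewrite E; field.
  rewrite -sum_dist; under eq_bigr do under eq_bigr do rewrite dist_coincidence.
  under eq_bigr do rewrite sumrB sumr_const card_ord exchange_big /=.
  rewrite sumrB sumr_const card_ord exchange_big /=.
  under [X in _ - X]eq_bigr do rewrite sum_coincidence //.
  by rewrite sumr_const card_ord; ring.
split => //.
  rewrite /G_crit sum_dist2 KE /G_LB; field.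
  by rewrite n10.
rewrite /Phi_SD.
have n_gt0 : (0 < n)%N by exact: ltnW.
under eq_bigr do under eq_bigr do rewrite SD2_coincidence //.
set F := fun k l => n%:R ^- 2 *
   (\sum_a \sum_b coincidence w D k a b * coincidence w D l a b) - A1 s w ^+ 2.
have Fsym k l : F k l = F l k.
  rewrite /F; congr (_ * _ - _).
  by apply: eq_bigr => a _; apply: eq_bigr => b _; rewrite mulrC.
(* Over all ordered pairs of columns, diagonal included, products of coincidences add up to the
   square of the total coincidence of two rows. *)
have sumF : \sum_k \sum_l F k l =
    n%:R ^- 2 * (\sum_a \sum_b (m%:R * A0 s w - dist w D a b) ^+ 2)
    - m%:R ^+ 2 * A1 s w ^+ 2.
  rewrite /F; under eq_bigr do rewrite sumrB sumr_const card_ord -mulr_sumr.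
  rewrite sumrB -mulr_sumr sumr_const card_ord; congr (_ * _ - _).
    under eq_bigr do rewrite exchange_big /=.
    rewrite exchange_big /=; apply: eq_bigr => a _.
    under eq_bigr do rewrite exchange_big /=.
    rewrite exchange_big /=; apply: eq_bigr => b _.
    rewrite dist_coincidence opprB addrC subrK expr2 mulr_suml.
    by apply: eq_bigr => k _; rewrite mulr_sumr.
  by ring.
have sumFd : \sum_k F k k =
    m%:R * (Bsum s w + 2 * Csum s w) - m%:R * A1 s w ^+ 2.
  have Fd k : F k k = (Bsum s w + 2 * Csum s w) - A1 s w ^+ 2.
    rewrite /F; congr (_ - _).
    under eq_bigr do under eq_bigr do rewrite -expr2.
    by rewrite sum_coincidence_sqr //; field.
  under eq_bigr do rewrite Fd.
  by rewrite sumr_const card_ord -[_ *+ _]mulr_natl mulrBr.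
have sumT : \sum_a \sum_b (m%:R * A0 s w - dist w D a b) ^+ 2 =
    n%:R ^+ 2 * (m%:R * A0 s w) ^+ 2
    - 2 * (m%:R * A0 s w) * (n%:R * (n%:R - 1) * K)
    + n%:R * (n%:R - 1) * K ^+ 2.
  rewrite -sum_dist -sum_dist2.
  have sq a b : (m%:R * A0 s w - dist w D a b) ^+ 2 =
     (m%:R * A0 s w) ^+ 2 - 2 * (m%:R * A0 s w) * dist w D a b
     + dist w D a b ^+ 2 by ring.
  under eq_bigr do under eq_bigr do rewrite sq.
  under eq_bigr do rewrite big_split sumrB sumr_const card_ord -mulr_sumr /=.
  rewrite big_split sumrB sumr_const card_ord -mulr_sumr /=.
  by ring.
(* [Phi_SD] averages over [k < l] only, hence half of the full sum without its diagonal. *)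
have -> : 2 / (m%:R * (m%:R - 1)) *
    (\sum_(k < m) \sum_(l < m | (k < l)%N) F k l) =
    (m%:R * (m%:R - 1))^-1 * (\sum_k \sum_l F k l - \sum_k F k k).
  by rewrite -sum_offdiag_sym // [2 / _]mulrC mulrA.
rewrite sumF sumFd sumT KE /Phi_SD_LB; field.
by rewrite n0 n10 m0 m10.
Qed.

(** * Coordinates of a finite field and base-[s] numerals *)

Lemma finField_coordinates (s p : nat) : prime s -> (0 < p)%N ->
  exists (F : finFieldType) (l : nat -> F -> 'F_s),
  [/\ #|F| = (s ^ p)%N, s \in [pchar F],
      forall i, {morph l i : x y / x + y} &
      forall x, (forall i, (i < p)%N -> l i x = 0) -> x = 0].
Proof.
move=> s_pr p0; have [F sF cardF] := pPrimePowerField s_pr p0.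
have [v vlin vbij] := pprimeChar_vectAxiom sF.
have vD : {morph v : x y / x + y} by move=> x y; rewrite -[x]scale1r vlin !scale1r.
have dimE : logn s #|pPrimeCharType sF| = p.
  by rewrite [X in logn _ X](_ : _ = (s ^ p)%N) // pfactorK.
(* Default index for [insubd], reached only when [i >= p]; separation of points involves only
   [i < p]. *)
have i0 : 'I_(logn s #|pPrimeCharType sF|) by rewrite dimE; exact: Ordinal p0.
pose l (i : nat) (x : F) : 'F_s := v x 0 (insubd i0 i).
exists F, l; split => // [i x y | x l0]; first by rewrite /l vD mxE.
have v0 : v 0 = 0 by apply: (addrI (v 0)); rewrite -vD !addr0.
apply: (bij_inj vbij); rewrite v0; apply/rowP => j; rewrite mxE.
by have := l0 j; rewrite /l valKd; apply; rewrite -[X in (_ < X)%N]dimE.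
Qed.

Lemma Fp_val_lt (s : nat) (a : 'F_s) : prime s -> (a < s)%N.
Proof. by move=> s_pr; rewrite -[X in (_ < X)%N](Fp_cast s_pr) ltn_ord. Qed.

(** New digits are appended on the right, so [l 0] is the most significant one and [collapse]
    amounts to truncation. *)
Fixpoint numeral (F : Type) (s : nat) (l : nat -> F -> 'F_s) (u : nat) (x : F)
    : nat :=
  if u is u'.+1 then (numeral l u' x * s + l u' x)%N else 0%N.

Lemma numeral_lt (F : Type) (s : nat) (l : nat -> F -> 'F_s) (u : nat) (x : F) :
  prime s -> (numeral l u x < s ^ u)%N.
Proof.
move=> s_pr; elim: u => [|u IH] /=; first by rewrite expn0.
have := Fp_val_lt (l u x) s_pr; rewrite expnSr; nia.
Qed.

Lemma collapse_numeral (F : Type) (s : nat) (l : nat -> F -> 'F_s)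
    (h u : nat) (x : F) : prime s -> (u <= h)%N ->
  collapse s h u (numeral l h x) = numeral l u x.
Proof.
move=> s_pr; elim: h => [|h IH].
  by rewrite leqn0 => /eqP ->; rewrite /collapse divn1.
rewrite leq_eqVlt => /predU1P[-> | uh]; first by rewrite /collapse subnn divn1.
rewrite -IH // /collapse subSn //= expnS divnMA divnMDl ?prime_gt0 //.
by rewrite [(l h x %/ s)%N]divn_small ?addn0 // Fp_val_lt.
Qed.

Lemma numeral_eq (F : Type) (s : nat) (l : nat -> F -> 'F_s) (u : nat)
    (x y : F) : prime s ->
  numeral l u x = numeral l u y <-> forall i, (i < u)%N -> l i x = l i y.
Proof.
move=> s_pr; split.
  move=> E i iu; apply: val_inj.
  (* Digit [i] is the last digit after truncation to [i.+1] digits. *)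
  have := congr1 (collapse s u i.+1) E; rewrite !collapse_numeral //=.
  by move/(congr1 (modn^~ s)); rewrite !modnMDl !modn_small ?Fp_val_lt.
elim: u => //= u IH E; rewrite E // IH // => i iu.
by apply: E; exact: ltnW.
Qed.

(** Digits are additive, so agreement of two numerals depends only on [x - y]. This makes distances
    functions of differences and fibres translates of one another. *)
Lemma numeral_sub (F : zmodType) (s : nat) (l : nat -> F -> 'F_s) (u : nat)
    (x y : F) : prime s -> (forall i, {morph l i : x y / x + y}) ->
  (numeral l u x == numeral l u y) = (numeral l u (x - y) == numeral l u 0).
Proof.
move=> s_pr lD; have l0 i : l i 0 = 0.
  by apply: (addrI (l i 0)); rewrite -lD !addr0.
have lB i : l i (x - y) = l i x - l i y.
  by apply: (addIr (l i y)); rewrite -lD !subrK.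
apply/eqP/eqP => /(numeral_eq l u _ _ s_pr) E; apply/numeral_eq => // i iu.
  by rewrite lB E // subrr l0.
by apply/eqP; rewrite -subr_eq0 -lB E // l0.
Qed.

(** The [p] digits separate points, so the full numeral is injective, hence bijective onto
    ['I_(s ^ p)] by counting; shorter numerals are its truncations. *)
Lemma numeral_surj (F : finZmodType) (s p : nat) (l : nat -> F -> 'F_s)
    (u v : nat) : prime s -> #|F| = (s ^ p)%N ->
  (forall i, {morph l i : x y / x + y}) ->
  (forall x, (forall i, (i < p)%N -> l i x = 0) -> x = 0) ->
  (u <= p)%N -> (v < s ^ u)%N -> exists x, numeral l u x = v.
Proof.
move=> s_pr cardF lD linj up vu; have l0 i : l i 0 = 0.
  by apply: (addrI (l i 0)); rewrite -lD !addr0.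
pose f x := Ordinal (numeral_lt l p x s_pr).
have f_inj : injective f.
  move=> x y /(congr1 val) /= /eqP; rewrite numeral_sub // => /eqP E.
  apply/eqP; rewrite -subr_eq0; apply/eqP/linj => i ip.
  by move/(numeral_eq l p _ _ s_pr): E => ->.
have [g fK gK] := inj_card_bij f_inj (eq_leq (etrans (card_ord _) (esym cardF))).
(* The digits of [v] are padded with [p - u] zeros. *)
have vp : (v * s ^ (p - u) < s ^ p)%N.
  rewrite -{2}(subnKC up) expnD ltn_pmul2r //.
  by rewrite expn_gt0 prime_gt0.
exists (g (Ordinal vp)); rewrite -(collapse_numeral l _ s_pr up).
have /(congr1 val) /= -> := gK (Ordinal vp).
by rewrite /collapse mulnK // expn_gt0 prime_gt0.
Qed.

(** * Fibres and functionals over the prime field *)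

Lemma card_fiber (V : finZmodType) (f : pred V) (g : pred V) (x0 y0 : V) :
  (forall x, f x = g (x + (y0 - x0))) -> #|f| = #|g|.
Proof.
move=> fg; rewrite -!sum1_card [in RHS](reindex_inj (addIr (y0 - x0))) /=.
by apply: eq_bigl => x; rewrite !unfold_in fg.
Qed.

(** Natural multiples stand for scalar multiplication by ['F_s], so additivity serves as
    linearity. *)
Lemma additive_muln (V W : zmodType) (l : V -> W) (x : V) (k : nat) :
  {morph l : x y / x + y} -> l (x *+ k) = l x *+ k.
Proof.
move=> lD; have l0 : l 0 = 0 by apply: (addrI (l 0)); rewrite -lD !addr0.
by elim: k => [|k IH]; rewrite ?mulr0n // !mulrS lD IH.
Qed.

Lemma mulrn_Fp (s : nat) (a b : 'F_s) : a *+ b = a * b.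
Proof. by rewrite -mulr_natr natr_Zp. Qed.

(** Otherwise the kernel of [a |-> l (x * a)] lies in that of [a |-> l (y * a)], so the second
    functional is [mu] times the first. Then [l] vanishes on all multiples of the nonzero
    [y - x *+ mu], that is, on the whole field. *)
Lemma functional_separates (s : nat) (F : fieldType) (l : F -> 'F_s)
    (x y z : F) : {morph l : x y / x + y} -> l z != 0 -> x != 0 ->
  (forall k, y != x *+ k) -> exists a, l (x * a) = 0 /\ l (y * a) != 0.
Proof.
move=> lD lz x0 yx; apply: contrapT => none.
have ker a : l (x * a) = 0 -> l (y * a) = 0.
  by move=> xa; apply/eqP/negPn/negP => ya; apply: none; exists a.
have lB u v : l (u - v) = l u - l v.
  by apply: (addIr (l v)); rewrite -lD !subrK.
(* Normalised so that the first functional takes the value 1 at [a0]. *)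
pose a0 := x^-1 * (z *+ (l z)^-1).
have la0 : l (x * a0) = 1.
  by rewrite /a0 mulVKf // additive_muln // mulrn_Fp divff.
pose mu := l (y * a0).
have prop a : l (y * a) = l (x * a) * mu.
  (* Subtracting a multiple of [a0] moves [a] into the kernel of the first functional. *)
  have : l (y * (a - a0 *+ l (x * a))) = 0.
    apply: ker; rewrite mulrBr mulrnAr lB additive_muln // la0.
    by rewrite mulrn_Fp mul1r subrr.
  rewrite mulrBr mulrnAr lB additive_muln // mulrn_Fp mulrC => /eqP.
  by rewrite subr_eq0 => /eqP ->; rewrite mulrC.
have d0 : y - x *+ mu != 0 by rewrite subr_eq0.
move/eqP: lz; apply; rewrite -(mulVKf d0 z) mulrBl lB.
set a := _ * z; rewrite mulrnAl additive_muln // mulrn_Fp prop subrr //.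
Qed.

(** Separation in both directions gives [a1] and [a2], each killed by exactly one functional; after
    rescaling they form a dual basis. *)
Lemma functional_pair_surj (s : nat) (F : fieldType) (l : F -> 'F_s)
    (x y z : F) (al be : 'F_s) : {morph l : x y / x + y} -> l z != 0 ->
  x != 0 -> y != 0 -> (forall k, y != x *+ k) -> (forall k, x != y *+ k) ->
  exists a, l (x * a) = al /\ l (y * a) = be.
Proof.
move=> lD lz x0 y0 yx xy.
have [a1 [xa1 ya1]] := functional_separates lD lz x0 yx.
have [a2 [ya2 xa2]] := functional_separates lD lz y0 xy.
exists (a1 *+ (be / l (y * a1)) + a2 *+ (al / l (x * a2))).
have lM u k : l (u *+ k) = l u *+ k by exact: additive_muln.
rewrite !mulrDr !mulrnAr !lD !lM !mulrn_Fp xa1 ya2 !mul0r.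
by rewrite add0r addr0 !(mulrC (l _)) !divfK.
Qed.

(** * The design of a set of multipliers *)

(** The invariance of sums of even functions over [A] under scaling gives equidistance;
    non-proportionality of elements of [A] gives strength 2. *)
Lemma field_design_attains (R : realType) (s p q m t : nat)
    (F : finFieldType) (l : nat -> F -> 'F_s) (A : {set F})
    (w : 'I_q.+1 -> R) :
  prime s -> (0 < q)%N -> (q <= p)%N -> (1 < m)%N ->
  #|F| = (s ^ p)%N -> (forall i, {morph l i : x y / x + y}) ->
  (forall x, (forall i, (i < p)%N -> l i x = 0) -> x = 0) ->
  #|A| = m -> 0 \notin A ->
  (forall f : F -> R, (forall x, f (- x) = f x) ->
     exists K, forall d, d != 0 -> \sum_(x in A) f (x * d) = K) ->
  (0 < t <= 2)%N ->
  (t = 2 -> forall x y k, x \in A -> y \in A -> x != y -> y != x *+ k) ->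
  exists D : design (s ^ p) m s q, is_GSOA D t /\ attains_LB w D.
Proof.
move=> s_pr q0 qp m1 cardF lD linj cardA A0 Abal t12 Aindep.
have s0 := prime_gt0 s_pr.
pose r (i : 'I_(s ^ p)) : F := enum_val (cast_ord (esym cardF) i).
pose r' (x : F) : 'I_(s ^ p) := cast_ord cardF (enum_rank x).
have rK : cancel r r' by move=> i; rewrite /r' enum_valK cast_ordKV.
have r'K : cancel r' r by move=> x; rewrite /r cast_ordK enum_rankK.
have card_r (P : pred F) : #|[pred i | P (r i)]| = #|P|.
  rewrite -!sum1_card [in RHS](reindex r); last by exists r' => ? _.
  by apply: eq_bigl => i; rewrite !unfold_in.
pose c (k : 'I_m) : F := enum_val (cast_ord (esym cardA) k).
have cA k : c k \in A by exact: enum_valP.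
have c0 k : c k != 0 by apply: contraNneq A0 => <-.
have c_inj : injective c by move=> k k' /enum_val_inj /cast_ord_inj.
pose D : design (s ^ p) m s q :=
  \matrix_(i, k) Ordinal (numeral_lt l q (c k * r i) s_pr).
have DE u i k : (u <= q)%N -> collapse s q u (D i k) = numeral l u (c k * r i).
  by move=> uq; rewrite mxE /= collapse_numeral.
(* Both pairs have the same difference, so translation by [z - y] carries the fibre through [y] to
   the fibre through [z]. *)
have shiftE u (k : 'I_m) x y z :
    (numeral l u (c k * x) == numeral l u (c k * y)) =
    (numeral l u (c k * (x + (z - y))) == numeral l u (c k * z)).
  rewrite numeral_sub // [in RHS]numeral_sub // -!mulrBr.
  by rewrite [z - y]addrC addrA addrK.
have UD : is_Utype D.
  have Dcard (k : 'I_m) x0 : #|[pred i | D i k == D x0 k]| =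
      #|[pred x | numeral l q (c k * x) == numeral l q (c k * r x0)]|.
    rewrite -card_r; apply: eq_card => i; rewrite !inE.
    by rewrite -(inj_eq val_inj) !mxE.
  have Dsurj (k : 'I_m) (v : 'I_(s ^ q)) : exists i, v = D i k.
    have [x xE] := numeral_surj s_pr cardF lD linj qp (ltn_ord v).
    exists (r' ((c k)^-1 * x)); apply: val_inj.
    by rewrite mxE /= r'K mulVKf // c0.
  move=> k v v'; have [i ->] := Dsurj k v; have [i' ->] := Dsurj k v'.
  rewrite !Dcard; apply: (@card_fiber _ _ _ (r i) (r i')) => x /=.
  exact: shiftE.
exists D; split; last first.
  (* Contribution of a column [c] to the distance, as a function of [c * (a - b)]; it is even
     because agreement is symmetric. *)
  pose f x : R := \sum_(u < q.+1)
    w u / s%:R ^+ u * (1 - (numeral l u x == numeral l u 0)%:R).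
  have fN x : f (- x) = f x.
    apply: eq_bigr => u _; congr (_ * (1 - (nat_of_bool _)%:R)).
    by rewrite -sub0r -numeral_sub // eq_sym.
  have [K fK] := Abal f fN.
  apply: (@attains_LB_equidistant _ _ _ _ _ w D K) => //.
    by rewrite -{1}(expn0 s) ltn_exp2l ?prime_gt1 //; apply: leq_trans qp.
  move=> a b ab; rewrite -(fK (r a - r b)); last first.
    by rewrite subr_eq0 (can_eq rK).
  rewrite big_enum_val [in RHS](reindex (cast_ord (esym cardA))) /=; last first.
    by exists (cast_ord cardA) => k _; rewrite ?cast_ordK ?cast_ordKV.
  apply: eq_bigr => k _; apply: eq_bigr => u _.
  have uq : (u <= q)%N by rewrite leq_ord.
  by rewrite deltaE // !DE // numeral_sub // -mulrBr.
(* Every level combination occurs. As [t <= 2], there is either one column, or two columns each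
   collapsed to its leading digit. *)
have surj g : (1 <= g <= t)%N -> forall e : 'I_g -> 'I_m, injective e ->
    forall u : 'I_g -> nat, (forall j, (0 < u j <= q)%N) ->
    (\sum_(j < g) u j)%N = t -> forall v : 'I_g -> nat,
    (forall j, (v j < s ^ u j)%N) ->
    exists x, forall j, numeral l (u j) (c (e j) * x) = v j.
  case: g => [//|[|[|g]]] gt e e_inj u uq ut v vu; last by exfalso; lia.
    have up : (u ord0 <= p)%N by have := uq ord0; lia.
    have [x xE] := numeral_surj s_pr cardF lD linj up (vu ord0).
    exists ((c (e ord0))^-1 * x) => j.
    by rewrite [j]ord1 mulVKf // c0.
  pose i0 : 'I_2 := ord0; pose i1 : 'I_2 := ord_max.
  have t2 : t = 2%N by lia.
  have [u0 u1] : u i0 = 1%N /\ u i1 = 1%N.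
    have := uq i0; have := uq i1; move: ut.
    rewrite big_ord_recl big_ord1 t2 (_ : lift _ _ = i1); last exact: val_inj.
    by rewrite /i0; lia.
  have p0 : (0 < p)%N by exact: leq_trans qp.
  have numeral1 x : numeral l 1 x = l 0%N x by rewrite /= mul0n.
  have [z z1] : exists z, numeral l 1 z = 1%N.
    by apply: (numeral_surj s_pr cardF lD linj p0); rewrite expn1 prime_gt1.
  have lz : l 0%N z != 0.
    by apply/eqP => lz; move: z1; rewrite numeral1 lz.
  have ne : c (e i0) != c (e i1) by rewrite (inj_eq c_inj) (inj_eq e_inj).
  have ne' : c (e i1) != c (e i0) by rewrite eq_sym.
  have [x [x0E x1E]] := functional_pair_surj
    (inZp (v i0)) (inZp (v i1)) (lD 0%N) lz (c0 (e i0)) (c0 (e i1))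
    (fun k => Aindep t2 _ _ k (cA _) (cA _) ne)
    (fun k => Aindep t2 _ _ k (cA _) (cA _) ne').
  exists x => j.
  have [-> | ->] : j = i0 \/ j = i1.
    by case: j => [[|[|j]] jlt] //; [left|right]; exact: val_inj.
    rewrite u0 numeral1 x0E /= Fp_cast // modn_small //.
    by have := vu i0; rewrite u0 expn1.
  rewrite u1 numeral1 x1E /= Fp_cast // modn_small //.
  by have := vu i1; rewrite u1 expn1.
move=> g gt e e_inj u uq ut; split.
  move=> i j; rewrite mxE; case/andP: (uq j) => _ ujq.
  by rewrite DE // numeral_lt.
move=> J cardJ v v' vu vu'.
(* A set of [g] among [g] columns is all of them. *)
have JT j : j \in J.
  suff -> : J = [set: 'I_g]%SET by rewrite inE.
  by apply/eqP; rewrite eqEcard finset.subsetT cardsT card_ord cardJ leqnn.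
have [x xE] := surj g gt e e_inj u uq ut v (fun j => vu j (JT j)).
have [x' xE'] := surj g gt e e_inj u uq ut v' (fun j => vu' j (JT j)).
have cntE (y : 'I_g -> nat) :
    #|[pred i | [forall j in J,
       (\matrix_(i, j) collapse s q (u j) (D i (e j))) i j == y j]]| =
    #|[pred a | [forall j, numeral l (u j) (c (e j) * a) == y j]]|.
  rewrite -card_r; apply: eq_card => i; rewrite !inE.
  apply: eq_forallb => j; rewrite JT mxE /= DE //.
  by case/andP: (uq j).
(* Both combinations occur, at [x] and [x'], so their fibres are translates. *)
rewrite !cntE; apply: (@card_fiber _ _ _ x x') => a /=.
by apply: eq_forallb => j; rewrite -xE -xE' -shiftE.
Qed.

(** * The full and the half set of nonzero elements *)

(* Comparing ranks in an enumeration of [F] selects one element of each pair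
   [{x, - x}]. *)
Lemma sum_nonzero_half (V : zmodType) (F : finFieldType) (f : F -> V) :
  2%:R != 0 :> F -> (forall x, f (- x) = f x) ->
  \sum_(x | x != 0) f x =
  (\sum_(x in [set x : F | (enum_rank x < enum_rank (- x)%R)%N]) f x) *+ 2.
Proof.
move=> two0 fN; set A := [set x : F | _].
(* Since 2 is invertible, [x] and [- x] differ for nonzero [x], so their ranks are strictly
   ordered. *)
have AE x : x != 0 -> (x \notin A) = (- x \in A).
  move=> x0; rewrite !inE opprK -leqNgt leq_eqVlt.
  case: eqP => // /val_inj /enum_rank_inj /eqP.
  by rewrite eq_sym -addr_eq0 -mulr2n -mulr_natr mulf_eq0 (negbTE x0) (negbTE two0).
have A0 x : x \in A -> x != 0.
  by rewrite inE; apply: contraTneq => ->; rewrite oppr0 ltnn.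
rewrite (bigID (fun x => x \in A)) /= mulr2n; congr (_ + _).
  by apply: eq_bigl => x; apply/andP/idP => [[]|xA] //; split => //; exact: A0.
rewrite (reindex_inj oppr_inj) /=; apply: eq_big => // x.
rewrite oppr_eq0; have [->|x0] := eqVneq x 0.
  by apply/esym/negbTE/negP => /A0; rewrite eqxx.
by rewrite AE ?oppr_eq0 // opprK.
Qed.

Lemma sum_nonzero_scale (V : zmodType) (F : finFieldType) (f : F -> V) (d : F) :
  d != 0 -> \sum_(x | x != 0) f (x * d) = \sum_(x | x != 0) f x.
Proof.
move=> d0; rewrite [RHS](reindex_inj (mulIf d0)) /=.
by apply: eq_bigl => x; rewrite mulf_eq0 (negbTE d0) orbF.
Qed.

(** Scaling permutes the nonzero elements. For [s = 2] the only multiples of [x] are 0 and [x], so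
    distinct nonzero elements are never proportional. *)
Lemma full_design_attains (R : realType) (s p q : nat) (w : 'I_q.+1 -> R) :
  prime s -> (0 < q)%N -> (q <= p)%N -> (2 <= s ^ p - 1)%N ->
  exists D : design (s ^ p) (s ^ p - 1) s q,
    is_GSOA D (if s == 2 then 2 else 1)%N /\ attains_LB w D.
Proof.
move=> s_pr q0 qp m2.
have p0 : (0 < p)%N by exact: leq_trans qp.
have [F [l [cardF sF lD linj]]] := finField_coordinates s_pr p0.
apply: (@field_design_attains _ _ _ _ _ _ F l [set~ 0]) => //.
- by rewrite cardsC1 cardF subn1.
- by rewrite !inE eqxx.
- move=> f _; exists (\sum_(x | x != 0) f x) => d d0.
  rewrite -(sum_nonzero_scale f d0).
  by apply: eq_bigl => x; rewrite !inE.
- by case: eqP.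
- case: eqP => // s2 _ x y k; rewrite !inE => x0 y0 xy.
  rewrite (divn_eq k s) mulrnDr mulnC mulrnA (mulrn_pchar sF) mul0rn add0r s2.
  by case: (k %% 2)%N (ltn_pmod k (isT : 0 < 2)%N) => [|[|]] //; rewrite eq_sym.
Qed.

(** For an even function, the sum over the half set is half of the scaling-invariant full sum. For
    [s = 3] the multiples of [x] are 0, [x] and [- x], and the half set never contains both [x] and
    [- x]. *)
Lemma half_design_attains (R : realType) (s p : nat) (w : 'I_p.+1 -> R) :
  prime s -> odd s -> (0 < p)%N -> (2 <= (s ^ p - 1) %/ 2)%N ->
  exists D : design (s ^ p) ((s ^ p - 1) %/ 2) s p,
    is_GSOA D (if s == 3 then 2 else 1)%N /\ attains_LB w D.
Proof.
move=> s_pr s_odd p0 m2.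
have [F [l [cardF sF lD linj]]] := finField_coordinates s_pr p0.
have two0 : 2%:R != 0 :> F.
  by rewrite -(dvdn_pcharf sF) -prime_coprime // coprimen2.
pose A := [set x : F | (enum_rank x < enum_rank (- x)%R)%N].
apply: (@field_design_attains _ _ _ _ _ _ F l A) => //.
(* The constant function 1 counts the half set. *)
- have := sum_nonzero_half (f := fun=> 1 : int) two0 (fun=> erefl).
  rewrite !sumr_const -mulrnA !natz => -[].
  have -> : #|[pred x : F | x != 0]| = (s ^ p - 1)%N.
    by rewrite -cardF subn1 -(cardsC1 (0 : F)); apply: eq_card => x; rewrite !inE.
  by move=> ->; rewrite mulnK.
- by rewrite inE oppr0 ltnn.
- move=> f fN; exists (\sum_(x in A) f x) => d d0.
  have fdN x : f (- x * d) = f (x * d) by rewrite mulNr fN.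
  have := sum_nonzero_scale f d0.
  rewrite (sum_nonzero_half two0 fN).
  rewrite (sum_nonzero_half (f := fun x => f (x * d)) two0 fdN).
  exact: pmulrnI.
- by case: eqP.
- case: eqP => // s3 _ x y k xA yA xy.
  have x0 : x != 0 by apply: contraTneq xA => ->; rewrite inE oppr0 ltnn.
  have y0 : y != 0 by apply: contraTneq yA => ->; rewrite inE oppr0 ltnn.
  rewrite (divn_eq k s) mulrnDr mulnC mulrnA (mulrn_pchar sF) mul0rn add0r s3.
  case: (k %% 3)%N (ltn_pmod k (isT : 0 < 3)%N) => [|[|[|]]] // _.
    by rewrite eq_sym.
  have -> : x *+ 2 = - x.
    apply/eqP; rewrite -addr_eq0 -mulrSr.
    by have := mulrn_pchar sF x; rewrite s3 => ->.
  (* Here [y = - x] would reverse the rank inequality that places [x] in [A]. *)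
  by apply: contraTneq yA => ->; rewrite inE opprK -leqNgt ltnW //; rewrite inE in xA.
Qed.

Local Close Scope ring_scope.

Theorem proposition1 (R : realType) :
  (forall s p q : nat, prime s -> (0 < q)%N -> (q <= p)%N ->
     (2 <= s ^ p - 1)%N ->
     forall w : 'I_q.+1 -> R, is_weight w ->
     exists D : design (s ^ p) (s ^ p - 1) s q,
       is_GSOA D (if s == 2%N then 2 else 1) /\ attains_LB w D)
  /\
  (forall s p : nat, prime s -> odd s -> (0 < p)%N ->
     (2 <= (s ^ p - 1) %/ 2)%N ->
     forall w : 'I_p.+1 -> R, is_weight w ->
     exists D : design (s ^ p) ((s ^ p - 1) %/ 2) s p,
       is_GSOA D (if s == 3%N then 2 else 1) /\ attains_LB w D).
Proof.
split=> [s p q s_pr q0 qp m2 w _ | s p s_pr s_odd p0 m2 w _].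
  exact: full_design_attains.
exact: half_design_attains.
Qed.
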